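(* Let $0<q<p\le1$, let $n\ge1$ and $m\ge0$ be integers and let $x\in[0,\infty)$. Then $$K_n(t^m,p,q;x)=\frac1{[m+1]_{p,q}}\sum_{j=0}^{m}\sum_{i=0}^{j}\binom{j}{i}\frac{p^i}{q^i[n]_{p,q}^{\,j-i}}\,S_n(t^{m+i-j},p,q;x).$$
   Context: For $0<q<p\le1$: $[n]_{p,q}=\frac{p^n-q^n}{p-q}$ for $n=0,1,2,\dots$; $[n]_{p,q}!=[n]_{p,q}[n-1]_{p,q}\cdots[1]_{p,q}$, $[0]_{p,q}!=1$; $E_{p,q}(x)=\sum_{n=0}^\infty q^{n(n-1)/2}\frac{x^n}{[n]_{p,q}!}$. The $(p,q)$-integral is $\int_0^a f(t)\,d_{p,q}t=(p-q)a\sum_{k=0}^\infty\frac{q^k}{p^{k+1}}f\big(\frac{q^k}{p^{k+1}}a\big)$ for $a\ge0$, and $\int_a^b f\,d_{p,q}t=\int_0^b f\,d_{p,q}t-\int_0^a f\,d_{p,q}t$. The $(p,q)$-Szász–Mirakjan basis functions are, for $n\ge1$, $k\ge0$, $x\in[0,\infty)$ (with $0^0=1$), $$s_{n,k}(p,q;x)=\frac{1}{E_{p,q}([n]_{p,q}x)}\,q^{k(k-1)/2}\frac{([n]_{p,q}x)^k}{[k]_{p,q}!}.$$ The $(p,q)$-Szász–Mirakjan operators are $$S_n(f,p,q;x)=\sum_{k=0}^\infty s_{n,k}(p,q;x)\,f\Big(\frac{[k]_{p,q}}{q^{k-1}[n]_{p,q}}\Big),$$ and their Kantorovich variant is $$K_n(f,p,q;x)=[n]_{p,q}\sum_{k=0}^\infty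 p^{-k}q^k s_{n,k}(p,q;x)\int_{[k]_{p,q}/(q^{k-1}[n]_{p,q})}^{[k+1]_{p,q}/(q^k[n]_{p,q})}f(t)\,d_{p,q}t ,$$ for $f\in C[0,\infty)$ for which the series converge. $\binom{j}{i}$ is the ordinary binomial coefficient, and $t^r$ denotes the function $t\mapsto t^r$ (with $t^0=1$). *)

(* Defs.v *)
From HB Require Import structures.
From mathcomp Require Import all_boot all_order all_algebra.
From mathcomp Require Import all_classical all_reals all_analysis.

Set Implicit Arguments.
Unset Strict Implicit.
Unset Printing Implicit Defensive.

Import Order.TTheory GRing.Theory Num.Theory.
Import numFieldNormedType.Exports.

Local Open Scope classical_set_scope.
Local Open Scope ring_scope.

Section PQCalculus.
Context {R : realType}.
Implicit Types (p q a b x t : R) (f : R -> R) (n k : nat).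

Definition pqnum p q n : R := (p ^+ n - q ^+ n) / (p - q).

Definition pqfact p q n : R := \prod_(1 <= i < n.+1) pqnum p q i.

Definition pqE_term p q x : R^nat :=
  fun k => q ^+ (k * k.-1)./2 * (x ^+ k / pqfact p q k).

Definition pqE p q x : R := limn (series (pqE_term p q x)).

Definition pqint0_term p q f a : R^nat :=
  fun k => q ^+ k / p ^+ k.+1 * f (q ^+ k / p ^+ k.+1 * a).

(* Integral from 0 to a; the series is meant for 0 <= a. *)
Definition pqint0 p q f a : R :=
  (p - q) * a * limn (series (pqint0_term p q f a)).

Definition pqint p q f a b : R := pqint0 p q f b - pqint0 p q f a.

Definition pqbasis p q n k x : R :=
  (pqE p q (pqnum p q n * x))^-1 *
  (q ^+ (k * k.-1)./2 * ((pqnum p q n * x) ^+ k / pqfact p q k)).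

(* The exponent k - 1 is an integer: it equals -1 at k = 0. *)
Definition pqnode p q n k : R :=
  pqnum p q k / (q ^ (k%:Z - 1) * pqnum p q n).

Definition pqSzasz_term p q n f x : R^nat :=
  fun k => pqbasis p q n k x * f (pqnode p q n k).

Definition pqSzasz p q n f x : R := limn (series (pqSzasz_term p q n f x)).

Definition pqKantorovich_term p q n f x : R^nat :=
  fun k => p ^- k * q ^+ k * pqbasis p q n k x *
           pqint p q f (pqnode p q n k) (pqnode p q n k.+1).

Definition pqKantorovich p q n f x : R :=
  pqnum p q n * limn (series (pqKantorovich_term p q n f x)).

(* Since limn is total, it has an unspecified value on a divergent sequence.
   The two predicates below say that f is in C[0, +oo) and that every series
   occurring in the value of the operator at x converges. *)
Definition pqSzasz_defined p q n f x : Prop :=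
  [/\ {within `[0, +oo[, continuous f},
      cvgn (series (pqE_term p q (pqnum p q n * x))) &
      cvgn (series (pqSzasz_term p q n f x))].

Definition pqKantorovich_defined p q n f x : Prop :=
  [/\ {within `[0, +oo[, continuous f},
      cvgn (series (pqE_term p q (pqnum p q n * x))),
      forall k, cvgn (series (pqint0_term p q f (pqnode p q n k))) &
      cvgn (series (pqKantorovich_term p q n f x))].

End PQCalculus.

(* Main.v *)
(* The (p,q)-integral of t^m from a to b is a geometric series with value
   (b^(m+1) - a^(m+1)) / [m+1].  Factor b - a out of b^(m+1) - a^(m+1).  When a
   and b are the k-th and (k+1)-st nodes, the recurrence [k+1] = p^k + q [k]
   shows that b - a cancels the prefactor [n] p^-k q^k, and the recurrence
   [k+1] = q^k + p [k] gives b = 1/[n] + (p/q) a, so the binomial theorem turns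
   each remaining b^j a^(m-j) into a combination of powers of a.  The Szasz
   series converge by the ratio test: [k+1] >= p^k bounds the ratio of
   consecutive terms by a multiple of (q/p)^k. *)
Require Import Defs.
From HB Require Import structures.
From mathcomp Require Import all_boot all_order all_algebra.
From mathcomp Require Import all_classical all_reals all_analysis.
From mathcomp Require Import ring.

Set Implicit Arguments.
Unset Strict Implicit.
Unset Printing Implicit Defensive.

Import Order.TTheory GRing.Theory Num.Theory.
Import numFieldNormedType.Exports.

Local Open Scope classical_set_scope.
Local Open Scope ring_scope.

(** * General facts on series, and a binomial expansion *)

(** As [v] tends to [0], the ratio is at most [1/2] from some [N] on, so the tail is dominated by
    [u N / 2^k]. *)
Lemma ratio_test_cvg_series (R : realType) (u v : R^nat) :
  (forall k, 0 <= u k) -> v @ \oo --> 0 ->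
  (\forall k \near \oo, u k.+1 <= v k * u k) -> cvgn (series u).
Proof.
move=> u0 v0 uv.
have [N _ uN] : \forall k \near \oo, u k.+1 <= 2^-1 * u k.
  near=> k; apply: le_trans (_ : v k * u k <= _); first by near: k.
  apply: ler_wpM2r => //; near: k.
  by move/cvgr_le: v0; apply; rewrite invr_gt0.
(* Only the tail from [N] on matters; it is reindexed to start at [0]. *)
rewrite -(is_cvg_series_restrict N).
suff /cvg_ex[l ul] : cvgn (series (fun k => u (k + N)%N)).
  apply/cvg_ex; exists l; rewrite -(cvg_shiftn N) /=.
  rewrite (_ : (fun n => _) = series (fun k => u (k + N)%N))//.
  by apply/funext => n; rewrite -{1}(add0n N) big_addn addnK.
apply: (@series_le_cvg _ _ (geometric (u N) 2^-1)) => [k|k|k|] //=.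
- by rewrite mulr_ge0 ?exprn_ge0 ?invr_ge0.
- elim: k => [|k IH]; first by rewrite expr0 mulr1.
  rewrite addSn exprS mulrCA (le_trans (uN _ (leq_addl _ _)))//.
  by rewrite ler_pM2l ?invr_gt0.
- apply: is_cvg_geometric_series.
  by rewrite ger0_norm ?invr_ge0// invf_lt1 ?ltr1n.
Unshelve. all: by end_near. Qed.

Lemma cvg_series_sum (R : realType) (I : eqType) (r : seq I) (f : I -> R^nat)
    (l : I -> R) :
  {in r, forall i, series (f i) @ \oo --> l i} ->
  series (fun k => \sum_(i <- r) f i k) @ \oo --> \sum_(i <- r) l i.
Proof.
elim: r => [_|i r IH fl].
  rewrite (_ : series _ = cst 0) ?big_nil; first exact: cvg_cst.
  by apply/funext => n; rewrite /series /= big1// => k _; rewrite big_nil.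
rewrite big_cons (_ : (fun k => _) = f i + (fun k => \sum_(j <- r) f j k)).
  rewrite seriesD; apply: cvgD; first by apply: fl; rewrite mem_head.
  by apply: IH => j jr; apply: fl; rewrite in_cons jr orbT.
by apply/funext => k; rewrite big_cons.
Qed.

Lemma cvg_seriesMl (R : realType) (c l : R) (f : R^nat) :
  series f @ \oo --> l -> series (fun k => c * f k) @ \oo --> c * l.
Proof.
move=> fl; rewrite (_ : (fun k => _) = c *: f)//.
by rewrite seriesZ; apply: cvgZl_tmp.
Qed.

(** Binomial theorem, with [i] counting the factors [p / q * a]. The bound [j <= m] lets the
    truncated subtraction merge [a ^+ (m - j) * a ^+ i] into one power. *)
Lemma exprMexprD_affine (F : fieldType) (c p q a : F) (m j : nat) :
  (j <= m)%N ->
  a ^+ (m - j) * (c^-1 + p / q * a) ^+ j =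
  \sum_(0 <= i < j.+1)
    'C(j, i)%:R * (p ^+ i / (q ^+ i * c ^+ (j - i))) * a ^+ (m + i - j).
Proof.
move=> jm; rewrite exprDn big_mkord mulr_sumr; apply: eq_bigr => i _.
rewrite -addnBAC// exprD exprVn !exprMn exprVn invfM -mulr_natl.
by ring.
Qed.

(** * (p,q)-integers, factorials and integrals of monomials *)

Section PQ.
Variables (R : realType) (p q : R).
Hypotheses (hq : 0 < q) (hqp : q < p).

Let hp : 0 < p. Proof. exact: lt_trans hqp. Qed.
Let q_ge0 : 0 <= q. Proof. exact: ltW. Qed.
Let p0 : p != 0. Proof. exact: lt0r_neq0. Qed.
Let q0 : q != 0. Proof. exact: lt0r_neq0. Qed.
Let pq0 : p - q != 0. Proof. by rewrite lt0r_neq0// subr_gt0. Qed.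

Lemma pqnumS n : pqnum p q n.+1 = p ^+ n + q * pqnum p q n.
Proof. by rewrite /pqnum !exprS; field. Qed.

Lemma pqnumSr n : pqnum p q n.+1 = q ^+ n + p * pqnum p q n.
Proof. by rewrite /pqnum !exprS; field. Qed.

Lemma pqnum0 : pqnum p q 0 = 0.
Proof. by rewrite /pqnum !expr0 subrr mul0r. Qed.

Lemma pqnum_ge0 n : 0 <= pqnum p q n.
Proof.
elim: n => [|n IH]; first by rewrite pqnum0.
by rewrite pqnumS addr_ge0 ?exprn_ge0 ?(mulr_ge0 q_ge0)// ltW.
Qed.

Lemma expr_le_pqnumS n : p ^+ n <= pqnum p q n.+1.
Proof. by rewrite pqnumS lerDl mulr_ge0 ?pqnum_ge0// ltW. Qed.

Lemma pqnum_gt0 n : (0 < n)%N -> 0 < pqnum p q n.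
Proof.
by case: n => // n _; rewrite (lt_le_trans _ (expr_le_pqnumS n))// exprn_gt0.
Qed.

Lemma pqnum_neq0 n : (0 < n)%N -> pqnum p q n != 0.
Proof. by move=> n0; rewrite lt0r_neq0// pqnum_gt0. Qed.

Lemma pqfact_gt0 n : 0 < pqfact p q n.
Proof.
rewrite /pqfact big_nat; apply: prodr_gt0 => i /andP[i0 _].
exact: pqnum_gt0.
Qed.

Lemma pqE_term_ge0 y k : 0 <= y -> 0 <= pqE_term p q y k.
Proof.
move=> y0; rewrite /pqE_term mulr_ge0 ?exprn_ge0 ?(ltW hq)//.
by rewrite divr_ge0 ?exprn_ge0// ltW// pqfact_gt0.
Qed.

Lemma pqE_termS y k :
  pqE_term p q y k.+1 = q ^+ k * y / pqnum p q k.+1 * pqE_term p q y k.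
Proof.
(* Pascal's rule for the triangular numbers ['C(k.+1, 2)]. *)
have e : ((k.+1 * k)./2 = (k * k.-1)./2 + k)%N.
  by have := bin2 k.+1; rewrite binS bin1 bin2.
rewrite /pqE_term e exprD exprS /pqfact big_nat_recr//=.
by field; rewrite pqnum_neq0//= lt0r_neq0// pqfact_gt0.
Qed.

(** The quotient [q^k / p^(k+1)] enters once as weight and [m] times through the monomial, so the
    ratio is [(q / p) ^+ m.+1 < 1]. The factor [(p - q) * a] of the integral is left out here. *)
Lemma cvg_pqint0_monomial m a :
  series (pqint0_term p q (fun t => t ^+ m) a) @ \oo -->
  a ^+ m / (p ^+ m.+1 - q ^+ m.+1).
Proof.
have lt1 : (q / p) ^+ m.+1 < 1.
  by rewrite exprn_ilt1 ?divr_ge0 ?ltW// ltr_pdivrMr// mul1r.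
have lt : q ^+ m.+1 < p ^+ m.+1 by rewrite ltrXn2r ?(ltW hq)// ltW.
have -> : pqint0_term p q (fun t => t ^+ m) a =
    geometric (a ^+ m / p ^+ m.+1) ((q / p) ^+ m.+1).
  apply/funext => k; rewrite /pqint0_term /= -exprM mulnC exprM expr_div_n.
  by rewrite !(exprS p) (exprS _ m) !(exprMn, exprVn, invfM); ring.
have -> : a ^+ m / (p ^+ m.+1 - q ^+ m.+1) =
    a ^+ m / p ^+ m.+1 * (1 - (q / p) ^+ m.+1)^-1.
  rewrite expr_div_n; field.
  by rewrite expf_neq0// lt0r_neq0// subr_gt0.
apply: cvg_geometric_series.
by rewrite ger0_norm// exprn_ge0// divr_ge0// ltW.
Qed.

Lemma pqint_monomial m a b :
  pqint p q (fun t => t ^+ m) a b =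
  (b ^+ m.+1 - a ^+ m.+1) / pqnum p q m.+1.
Proof.
have lt : q ^+ m.+1 < p ^+ m.+1 by rewrite ltrXn2r ?(ltW hq)// ltW.
rewrite /pqint /pqint0 !(cvg_lim _ (@cvg_pqint0_monomial m _))// /pqnum.
rewrite [b ^+ m.+1]exprS [a ^+ m.+1]exprS; field.
by rewrite pq0 -?exprS lt0r_neq0// subr_gt0.
Qed.

(** * Nodes, Szasz series and the Kantorovich identity for a fixed [n] *)

Section Node.
Variables (n : nat) (n0 : (0 < n)%N).
Let N := pqnum p q n.
Let N0 : N != 0. Proof. exact: pqnum_neq0. Qed.

(** Trades the integer exponent [k - 1] for a natural one, uniformly in [k], including [k = 0]. *)
Lemma pqnodeE k : pqnode p q n k = q * pqnum p q k / (q ^+ k * N).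
Proof.
rewrite /pqnode -/N expfzDr// exprN1 -exprnP.
by field; rewrite N0 q0 expf_neq0.
Qed.

Lemma pqnode_ge0 k : 0 <= pqnode p q n k.
Proof.
rewrite pqnodeE divr_ge0 ?(mulr_ge0 q_ge0, pqnum_ge0)//.
exact: mulr_ge0 (exprn_ge0 _ q_ge0) (pqnum_ge0 n).
Qed.

Lemma pqnodeS k : pqnode p q n k.+1 = N^-1 + p / q * pqnode p q n k.
Proof.
by rewrite !pqnodeE pqnumSr exprS; field; rewrite N0 q0 expf_neq0.
Qed.

Lemma pqnodeB k :
  pqnode p q n k.+1 - pqnode p q n k = p ^+ k / (q ^+ k * N).
Proof.
by rewrite !pqnodeE pqnumS exprS; field; rewrite N0 q0 expf_neq0.
Qed.

Lemma inv_le_pqnodeS k : N^-1 <= pqnode p q n k.+1.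
Proof. by rewrite pqnodeS lerDl mulr_ge0 ?pqnode_ge0// divr_ge0// ltW. Qed.

(** The summand [N^-1] in the node recurrence is absorbed by the preceding node. The index is
    shifted because node [0] vanishes and cannot absorb it. *)
Lemma pqnodeSS_le k :
  pqnode p q n k.+2 <= (1 + p / q) * pqnode p q n k.+1.
Proof. by rewrite pqnodeS mulrDl mul1r lerD2r inv_le_pqnodeS. Qed.

(** Serves both the exponential series ([r = 0]) and the Szasz series of [t ^+ r]. *)
Lemma cvg_pqE_term_moment y r : 0 <= y ->
  cvgn (series (fun k => pqE_term p q y k * pqnode p q n k ^+ r)).
Proof.
move=> y0.
(* The factor [y * (q / p) ^+ k] bounds the ratio of the exponential terms, and [(1 + p / q) ^+ r]
   that of the node powers. *)
apply: (@ratio_test_cvg_series _ _ (geometric (y * (1 + p / q) ^+ r) (q / p))).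
- by move=> k; rewrite mulr_ge0 ?pqE_term_ge0 ?exprn_ge0 ?pqnode_ge0.
- apply: cvg_geometric; rewrite ger0_norm ?divr_ge0 ?ltW//.
  by rewrite ltr_pdivrMr// mul1r.
(* The ratio bound is claimed from index [1] on, past the vanishing node. *)
exists 1%N => // -[//|k] _ /=.
rewrite pqE_termS.
set e := pqE_term _ _ _ _; set b := pqnode _ _ _ k.+2.
set a := pqnode _ _ _ k.+1; set c := 1 + p / q.
have e0 : 0 <= e by exact: pqE_term_ge0.
have -> : y * c ^+ r * (q / p) ^+ k.+1 * (e * a ^+ r) =
    q ^+ k.+1 * y / p ^+ k.+1 * e * (c * a) ^+ r.
  by rewrite [(c * a) ^+ r]exprMn expr_div_n; ring.
have qy0 : 0 <= q ^+ k.+1 * y by rewrite mulr_ge0 ?exprn_ge0// ltW.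
rewrite ler_pM ?exprn_ge0 ?pqnode_ge0//.
- by rewrite mulr_ge0// divr_ge0// pqnum_ge0.
- rewrite ler_wpM2r// ler_wpM2l// lef_pV2 ?posrE ?exprn_gt0 ?pqnum_gt0//.
  exact: expr_le_pqnumS.
- rewrite lerXn2r ?nnegrE ?pqnode_ge0 ?pqnodeSS_le//.
  exact: le_trans (pqnode_ge0 k.+2) (pqnodeSS_le k).
Qed.

Lemma cvg_pqE y : 0 <= y -> cvgn (series (pqE_term p q y)).
Proof.
move=> /(@cvg_pqE_term_moment y 0).
by under eq_fun do rewrite expr0 mulr1.
Qed.

Lemma cvg_pqSzasz_monomial r x : 0 <= x ->
  cvgn (series (pqSzasz_term p q n (fun t => t ^+ r) x)).
Proof.
move=> x0; have y0 : 0 <= N * x by rewrite mulr_ge0 ?pqnum_ge0.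
apply/cvg_ex; eexists.
rewrite (_ : pqSzasz_term _ _ _ _ _ = fun k => (pqE p q (N * x))^-1 *
  (pqE_term p q (N * x) k * pqnode p q n k ^+ r)).
  apply: cvg_seriesMl; exact: (@cvg_pqE_term_moment _ r y0).
by apply/funext => k; rewrite mulrA.
Qed.

(** The theorem's identity already holds term by term. The extra [N^-1] comes from the difference of
    consecutive nodes and later cancels the outer factor of the operator. *)
Lemma pqKantorovich_term_monomial m x k :
  pqKantorovich_term p q n (fun t => t ^+ m) x k =
  (N * pqnum p q m.+1)^-1 *
  \sum_(0 <= j < m.+1) \sum_(0 <= i < j.+1)
    'C(j, i)%:R * (p ^+ i / (q ^+ i * N ^+ (j - i))) *
    pqSzasz_term p q n (fun t => t ^+ (m + i - j)) x k.
Proof.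
rewrite /pqKantorovich_term pqint_monomial.
set a := pqnode p q n k; set b := pqnode p q n k.+1; set s := pqbasis _ _ _ _ _.
have -> : b ^+ m.+1 - a ^+ m.+1 =
    p ^+ k / (q ^+ k * N) * \sum_(0 <= j < m.+1) a ^+ (m - j) * b ^+ j.
  (* Factoring [a ^+ m.+1 - b ^+ m.+1] and changing signs puts the exponent [j] on [b], as
     [exprMexprD_affine] requires. *)
  by rewrite -pqnodeB -opprB subrXX -mulNr opprB big_mkord.
have -> : \sum_(0 <= j < m.+1) \sum_(0 <= i < j.+1)
    'C(j, i)%:R * (p ^+ i / (q ^+ i * N ^+ (j - i))) *
    pqSzasz_term p q n (fun t => t ^+ (m + i - j)) x k =
    s * \sum_(0 <= j < m.+1) a ^+ (m - j) * b ^+ j.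
  rewrite mulr_sumr; apply: eq_big_nat => j /= jm.
  rewrite /b pqnodeS exprMexprD_affine// mulr_sumr.
  by apply: eq_big_nat => i _; rewrite mulrCA.
by field; rewrite N0 pqnum_neq0 ?expf_neq0.
Qed.

(** The double sum is finite and each Szasz series converges, so the termwise identity can be
    summed. Stating a limit yields both convergence and value. *)
Lemma cvg_pqKantorovich_monomial m x : 0 <= x ->
  series (pqKantorovich_term p q n (fun t => t ^+ m) x) @ \oo -->
  (N * pqnum p q m.+1)^-1 *
  \sum_(0 <= j < m.+1) \sum_(0 <= i < j.+1)
    'C(j, i)%:R * (p ^+ i / (q ^+ i * N ^+ (j - i))) *
    pqSzasz p q n (fun t => t ^+ (m + i - j)) x.
Proof.
move=> x0; rewrite (funext (pqKantorovich_term_monomial m x)).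
apply: cvg_seriesMl; apply: cvg_series_sum => j _.
apply: cvg_series_sum => i _; apply: cvg_seriesMl.
exact: cvg_pqSzasz_monomial.
Qed.

End Node.
End PQ.

Theorem lemma2 (R : realType) (p q : R) (hq : 0 < q) (hqp : q < p)
    (hp : p <= 1) (n m : nat) (hn : (1 <= n)%N) (x : R) (hx : 0 <= x) :
  [/\ pqKantorovich_defined p q n (fun t => t ^+ m) x,
      forall r : nat, (r <= m)%N ->
        pqSzasz_defined p q n (fun t => t ^+ r) x &
      pqKantorovich p q n (fun t => t ^+ m) x =
      (pqnum p q m.+1)^-1 *
      \sum_(0 <= j < m.+1) \sum_(0 <= i < j.+1)
        'C(j, i)%:R * (p ^+ i / (q ^+ i * pqnum p q n ^+ (j - i)))
        * pqSzasz p q n (fun t => t ^+ (m + i - j)) x].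
Proof.
have y0 : 0 <= pqnum p q n * x by rewrite mulr_ge0 ?pqnum_ge0.
have Xc r : {within `[0, +oo[, continuous (fun t : R => t ^+ r)}.
  by apply: continuous_subspaceT; exact: exprn_continuous.
have cvE := cvg_pqE hq hqp hn y0.
have cvK := cvg_pqKantorovich_monomial (m := m) hq hqp hn hx.
split.
- split => //; last exact: cvgP cvK.
  by move=> k; apply: cvgP; exact: cvg_pqint0_monomial.
- by move=> r _; split => //; exact: cvg_pqSzasz_monomial.
- rewrite /pqKantorovich (cvg_lim _ cvK)// mulrA invfM mulrA.
  by rewrite divff ?mul1r// pqnum_neq0.
Qed.
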